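(* Let $q$ be a power of $2$ and let $r,s$ be positive integers with $s\equiv r+2\pmod{q+1}$. Let $B(x)\in\mathbb{F}_{q^2}[x]$ be such that $B(x)$ has no root in $\mu_{q+1}$ and $x\mapsto x^{r}B^{(q)}(1/x)/B(x)$ permutes $\mu_{q+1}$. Let $a\in\mathbb{F}_{q^2}\setminus\mathbb{F}_q$ and $b\in\mathbb{F}_q^{*}$. Then $$x^{s}B(x^{q-1})\left(ax^{2(q-1)}+bx^{q-1}+a^{q}\right)$$ permutes $\mathbb{F}_{q^2}$ if and only if $\gcd(s,q-1)=1$ and $\mathrm{Tr}\left(\frac{a^{q+1}}{b^{2}}\right)\neq 1$.
   Context: $\mu_{q+1}$ denotes the set of $(q+1)$-th roots of unity in $\mathbb{F}_{q^2}$. For $B(x)\in\mathbb{F}_{q^2}[x]$, $B^{(q)}(x)$ denotes the polynomial obtained from $B(x)$ by raising every coefficient to the $q$-th power. $\mathrm{Tr}$ is the absolute trace $\mathbb{F}_q\to\mathbb{F}_2$, $\mathrm{Tr}(x)=x+x^2+x^{2^2}+\cdots+x^{2^{m-1}}$ where $q=2^m$. A polynomial permutes a finite set if it induces a bijection of that set onto itself. *)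

(* Defs.v *)
From mathcomp Require Import all_boot all_order all_algebra.

Set Implicit Arguments.
Unset Strict Implicit.
Unset Printing Implicit Defensive.

Import GRing.Theory.
Local Open Scope ring_scope.

Definition permutes (T : finType) (A : {set T}) (f : T -> T) : Prop :=
  {in A &, injective f} /\ f @: A = A.

Definition mu (L : finFieldType) (n : nat) : {set L} :=
  [set x : L | n.-unity_root x].

(* For #|L| = q ^ 2, this is the unique subfield of L with q elements. *)
Definition Fq (L : finFieldType) (q : nat) : {set L} :=
  [set x : L | x ^+ q == x].

Definition conj_poly (L : finFieldType) (q : nat) (B : {poly L}) : {poly L} :=
  map_poly (fun c : L => c ^+ q) B.

(* On Fq L (2 ^ m) this is the absolute trace to the prime field {0, 1},
   with its values seen in L. *)
Definition Tr (L : finFieldType) (m : nat) (x : L) : L :=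
  \sum_(i < m) x ^+ (2 ^ i).

(* Main.v *)
Require Import Defs.
From mathcomp Require Import all_boot all_order all_algebra.
From mathcomp Require Import finfield cyclic ring.

(** On y in mu_(q+1) the polynomial M(y) = a y^2 + b y + a^q satisfies
    y^2 M(y)^q = M(y). Hence, where M does not vanish, y^s (B M)(y)^(q-1) is the
    given permutation y^r B^(q)(1/y) / B(y), and x^s h(x^(q-1)) permutes the field
    as soon as gcd(s, q-1) = 1, h has no zero on mu_(q+1) and y^s h(y)^(q-1) is
    injective there; the first two conditions are also necessary. The substitution
    y = (b/a) z turns M into z^2 + z + c with c = a^(q+1)/b^2, and y lies in
    mu_(q+1) iff z^q = z + 1; since z^q + z telescopes to Tr(z^2 + z) = Tr c, this
    happens iff Tr c = 1. *)

Set Implicit Arguments.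
Unset Strict Implicit.
Unset Printing Implicit Defensive.

Import GRing.Theory.
Local Open Scope ring_scope.

(** Squaring is additive in characteristic 2, so the [i]-th term is z^(2^(i+1)) - z^(2^i) and the
    sum telescopes. *)
Lemma sum_expr_sqrD (R : comNzRingType) (n : nat) (z : R) :
  2%N \in [pchar R] ->
  \sum_(i < n) (z ^+ 2 + z) ^+ (2 ^ i) = z ^+ (2 ^ n) - z.
Proof.
move=> char2; rewrite -[z in RHS]expr1 -[1%N]/(2 ^ 0)%N.
rewrite -(telescope_sumr (fun i => z ^+ (2 ^ i))) // big_mkord.
apply: eq_bigr => i _.
rewrite (GRing.subr_pchar2 char2) exprDn_pchar ?pnatX ?pnatE ?char2 //.
by rewrite -exprM expnS.
Qed.

Lemma expr_eq1_neq0 (R : nzRingType) (x : R) (n : nat) :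
  (0 < n)%N -> x ^+ n = 1 -> x != 0.
Proof.
by move=> n_gt0; apply: contra_eq_neq => ->; rewrite expr0n gtn_eqF // eq_sym oner_neq0.
Qed.

Lemma finField_prim_root (F : finFieldType) :
  exists g : F, #|F|.-1.-primitive_root g.
Proof.
have gt1 := finNzRing_gt1 F.
have eqF : #|F|.-1.+1 = #|F| by rewrite prednK // ltnW.
have: has #|F|.-1.-primitive_root (enum (predC1 (0 : F))).
  apply: has_prim_root; rewrite ?enum_uniq //.
  - by rewrite -ltnS eqF.
  - apply/allP=> x; rewrite mem_enum /= => nz_x.
    by rewrite unity_rootE -(inj_eq (mulfI nz_x)) -exprS eqF expf_card mulr1.
  - by rewrite -cardE cardC1.
by case/hasP=> g _ gP; exists g.
Qed.

Lemma horner_conj_poly (L : finFieldType) (q : nat) (B : {poly L}) (x : L) :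
  [pchar L].-nat q -> (conj_poly q B).[x ^+ q] = B.[x] ^+ q.
Proof.
move=> charq; rewrite horner_poly horner_coef.
have q_gt0 : (0 < q)%N by case/andP: charq.
rewrite (big_morph (fun u : L => u ^+ q) (id1 := 0) (op1 := +%R)).
- by apply: eq_bigr => i _; rewrite exprMn exprAC.
- by move=> u v; exact: exprDn_pchar.
- by rewrite expr0n -[q]prednK.
Qed.

(* With T = X + X^2 + ... + X^(2^(n-1)), the polynomial X^2 + X - c divides
   T(X^2 + X) - T(c) = X^(2^n) - X, which splits over F. *)
Lemma artin_schreier_root (F : finFieldType) (n : nat) (c : F) :
  #|F| = (2 ^ n)%N -> \sum_(i < n) c ^+ (2 ^ i) = 0 ->
  exists z : F, z ^+ 2 + z = c.
Proof.
move=> cardF trc0; have char2 := card_finPcharP cardF (isT : prime 2).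
pose w : {poly F} := 'X^2 + 'X; pose p := w - c%:P.
have size_p : size p = 3.
  rewrite /p /w -addrA size_polyDl ?size_polyXn //.
  by rewrite size_XsubC.
have: p %| \prod_(x : F) ('X - x%:P).
  rewrite -finField_genPoly cardF -sum_expr_sqrD; last by rewrite pchar_poly.
  have <- : \sum_(i < n) (w ^+ (2 ^ i) - c%:P ^+ (2 ^ i))
          = \sum_(i < n) w ^+ (2 ^ i).
    rewrite sumrB.
    under [X in _ - X]eq_bigr => i _ do rewrite -polyC_exp.
    by rewrite -rmorph_sum trc0 rmorph0 subr0.
  apply: (big_ind (fun u => p %| u)) => [|u v pu pv|i _].
  - exact: dvdp0.
  - exact: dvdp_add.
  - by rewrite subrXX dvdp_mulr.
case/dvdp_prod_XsubC=> ms eq_p.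
case: (mask ms _) eq_p => [|z zs] eq_p.
  by move/eqp_size: eq_p; rewrite size_p big_nil size_poly1.
have: root p z by rewrite (eqp_root eq_p) big_cons rootM root_XsubC eqxx.
by rewrite rootE !hornerE subr_eq0 => /eqP zP; exists z.
Qed.

Lemma mu_quadratic_root (L : finFieldType) (m q : nat) (a b : L) :
  q = (2 ^ m)%N -> #|L| = (q ^ 2)%N -> a != 0 -> b \in Fq L q -> b != 0 ->
  (exists2 y, y \in mu L (q + 1) & a * y ^+ 2 + b * y + a ^+ q = 0) <->
  Tr m (a ^+ (q + 1) / b ^+ 2) = 1.
Proof.
move=> def_q cardL nz_a; rewrite inE => /eqP bq nz_b.
have cardL2 : #|L| = (2 ^ (m + m))%N by rewrite cardL def_q -expnM muln2 addnn.
have char2 := card_finPcharP cardL2 (isT : prime 2).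
set c := _ / _.
have nz_c : c != 0 by rewrite mulf_neq0 ?invr_eq0 ?expf_neq0.
have trE z : z ^+ 2 + z = c -> Tr m c = z ^+ q - z.
  by move=> <-; rewrite /Tr sum_expr_sqrD // def_q.
split=> [[y]|trc].
  rewrite inE unity_rootE addn1 => /eqP y1 My.
  have nz_y := expr_eq1_neq0 (ltn0Sn q) y1.
  pose z := a * y / b.
  have nz_z : z != 0 by rewrite !mulf_neq0 ?invr_eq0.
  have zc : z ^+ 2 + z = c.
    apply/eqP; rewrite -subr_eq0 (GRing.subr_pchar2 char2) /c /z.
    rewrite addn1 [a ^+ q.+1]exprS.
    have -> : (a * y / b) ^+ 2 + a * y / b + a * a ^+ q / b ^+ 2
            = a / b ^+ 2 * (a * y ^+ 2 + b * y + a ^+ q).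
      by field.
    by rewrite My mulr0.
  (* The norm to F_q of z is c because y has norm 1 and b^(q+1) = b^2. Comparing with z^2 + z = c
     and cancelling z gives z^q = z + 1. *)
  have zq : z ^+ q * z = c.
    by rewrite -exprSr /c /z !exprMn y1 mulr1 exprVn [b ^+ q.+1]exprS bq addn1.
  rewrite (trE z zc); apply/eqP; rewrite subr_eq; apply/eqP/(mulIf nz_z).
  by rewrite zq -zc mulrDl mul1r -expr2 addrC.
have cq : c ^+ q = c.
  rewrite /c expr_div_n [b ^+ 2 ^+ q]exprAC bq exprAC addn1 exprSr -exprM.
  by rewrite mulnn -cardL expf_card -exprS.
(* The absolute trace of [L] has 2m terms. As c lies in F_q, its last m terms repeat the first m, so
   the trace vanishes in characteristic 2. *)
have [z zc] : exists z, z ^+ 2 + z = c.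
  apply: (artin_schreier_root cardL2).
  rewrite big_split_ord /=.
  under [X in _ + X]eq_bigr => i _ do rewrite expnD exprM -def_q cq.
  by rewrite (addrr_pchar2 char2).
have zq : z ^+ q = z + 1 by move: trc; rewrite (trE z zc) => /eqP; rewrite subr_eq addrC => /eqP.
have zq1 : z ^+ (q + 1) = c by rewrite exprD zq mulrDl expr1 mul1r -expr2.
(* The substitution z = a y / b is inverted; this y has norm b^2 c / a^(q+1) = 1. *)
exists (b * z / a).
  rewrite inE unity_rootE !exprMn zq1 exprVn /c addn1 [b ^+ q.+1]exprSr bq.
  by apply/eqP; field; rewrite expf_neq0.
have -> : a * (b * z / a) ^+ 2 + b * (b * z / a) + a ^+ q
   = b ^+ 2 / a * (z ^+ 2 + z + c).
  by rewrite /c addn1 [a ^+ q.+1]exprS; field; rewrite nz_a nz_b.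
by rewrite zc (addrr_pchar2 char2) mulr0.
Qed.

Section PowerMaps.

Variables (L : finFieldType) (q : nat).
Hypothesis cardL : #|L| = (q ^ 2)%N.

Lemma card_pred_sqr : #|L|.-1 = ((q - 1) * (q + 1))%N.
Proof. by rewrite cardL -subn_sqr exp1n subn1. Qed.

Lemma expr_subn1_mu (x : L) : x != 0 -> x ^+ (q - 1) \in mu L (q + 1).
Proof.
move=> nz_x; rewrite inE unity_rootE -exprM -card_pred_sqr.
rewrite -(inj_eq (mulfI nz_x)) mulr1 -exprS.
by rewrite (prednK (ltnW (finNzRing_gt1 L))) expf_card.
Qed.

(** With y = g^k for a generator g of the cyclic group of order (q-1)(q+1), y^(q+1) = 1 forces q-1
    to divide k. *)
Lemma mu_expr_subn1 (y : L) :
  y \in mu L (q + 1) -> exists2 x, x != 0 & x ^+ (q - 1) = y.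
Proof.
rewrite inE unity_rootE => /eqP y1.
have [g gP] := finField_prim_root L.
have y2 : y ^+ #|L|.-1 = 1 by rewrite card_pred_sqr mulnC exprM y1 expr1n.
have [[k lt_k] /= def_y] := prim_rootP gP y2.
have := prim_order_dvd gP (k * (q + 1)).
rewrite exprM -def_y y1 eqxx card_pred_sqr dvdn_pmul2r ?addn1 // => /dvdnP[j def_k].
exists (g ^+ j); last by rewrite -exprM -def_k.
by rewrite expf_neq0 // (expr_eq1_neq0 (prim_order_gt0 gP)) ?(prim_expr_order gP).
Qed.

Variables (s : nat) (h : L -> L).
Hypothesis s_gt0 : (0 < s)%N.

(** The (q-1)-th power of the value at x is y^s h(y)^(q-1) with y = x^(q-1). So the value determines
    y, then x^s after division by h(y), and finally x by coprimality. *)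
Lemma inj_power_map :
  gcdn s (q - 1) = 1%N ->
  {in mu L (q + 1), forall y, h y != 0} ->
  {in mu L (q + 1) &, injective (fun y => y ^+ s * h y ^+ (q - 1))} ->
  injective (fun x => x ^+ s * h (x ^+ (q - 1))).
Proof.
move=> cop nz_h inj_h x1 x2 /= eq_f.
have f0 x : (x ^+ s * h (x ^+ (q - 1)) == 0) = (x == 0).
  have [->|nz_x] := eqVneq x 0; first by rewrite expr0n gtn_eqF // mul0r eqxx.
  by apply: negbTE; rewrite mulf_neq0 ?expf_neq0 ?nz_h ?expr_subn1_mu.
have [x1_0|nz_x1] := eqVneq x1 0.
  by move: (f0 x2); rewrite -eq_f f0 x1_0 eqxx => /esym/eqP->.
have nz_x2 : x2 != 0 by rewrite -f0 -eq_f f0.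
have eq_y : x1 ^+ (q - 1) = x2 ^+ (q - 1).
  apply: inj_h; rewrite ?expr_subn1_mu //=.
  by rewrite ![_ ^+ (q - 1) ^+ s]exprAC -!exprMn eq_f.
have eq_s : x1 ^+ s = x2 ^+ s.
  move: eq_f; rewrite eq_y; apply: mulIf.
  by rewrite nz_h ?expr_subn1_mu.
(* Bezout in the form u s = v (q-1) + 1 expresses x through x^s and x^(q-1). *)
have [u v uv _] := egcdnP (q - 1) s_gt0.
have powE x : x ^+ (q - 1) ^+ v * x = x ^+ s ^+ u :> L.
  by rewrite -!exprM ![(_ * v)%N]mulnC [(s * u)%N]mulnC uv cop addn1 exprSr.
apply: (mulfI (expf_neq0 v (expf_neq0 (q - 1) nz_x1))).
by rewrite powE eq_s -powE eq_y.
Qed.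

(** An element [e] of order d = gcd(s, q-1) satisfies e^s = e^(q-1) = 1, so [e] and 1 have the same
    image h(1); injectivity forces d = 1. *)
Lemma inj_power_map_gcdn :
  injective (fun x => x ^+ s * h (x ^+ (q - 1))) -> gcdn s (q - 1) = 1%N.
Proof.
move=> inj_f; have [g gP] := finField_prim_root L.
set d := gcdn s (q - 1).
have d_dvd : (d %| #|L|.-1)%N by rewrite card_pred_sqr dvdn_mulr ?dvdn_gcdr.
pose e := g ^+ (#|L|.-1 %/ d).
have e_d k : (d %| k)%N -> e ^+ k = 1.
  by move=> /dvdnP[j ->]; rewrite mulnC exprM -[e ^+ d]exprM divnK // (prim_expr_order gP) expr1n.
have e1 : e = 1.
  by apply: inj_f; rewrite !e_d ?dvdn_gcdl ?dvdn_gcdr // !expr1n.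
have n_gt0 := prim_order_gt0 gP.
have : (#|L|.-1 %| #|L|.-1 %/ d)%N by rewrite (prim_order_dvd gP) -/e e1.
rewrite -{1}(divnK d_dvd) -{2}[(_ %/ d)%N]muln1.
by rewrite dvdn_pmul2l ?dvdn1 ?divn_gt0 ?(dvdn_leq n_gt0) ?(dvdn_gt0 n_gt0) // => /eqP.
Qed.

(** A zero of h at y = x^(q-1) would give the nonzero x the same image as 0. *)
Lemma inj_power_map_neq0 :
  injective (fun x => x ^+ s * h (x ^+ (q - 1))) ->
  {in mu L (q + 1), forall y, h y != 0}.
Proof.
move=> inj_f _ /mu_expr_subn1[x nz_x <-]; apply: contraNneq nz_x => hx0.
by apply/eqP/inj_f; rewrite hx0 expr0n gtn_eqF // mulr0 mul0r.
Qed.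

End PowerMaps.

Lemma permutes_setT (T : finType) (f : T -> T) :
  permutes [set: T] f <-> injective f.
Proof.
split=> [[inj_f _]|inj_f]; first by move=> x y; apply: inj_f; rewrite inE.
split; first by move=> x y _ _; apply: inj_f.
by apply/eqP; rewrite eqEcard subsetT (card_imset _ inj_f) leqnn.
Qed.

Theorem theorem3p5 (m q : nat) (hm : (0 < m)%N) (hq : q = (2 ^ m)%N)
    (L : finFieldType) (hL : #|L| = (q ^ 2)%N)
    (r s : nat) (hr : (0 < r)%N) (hs : (0 < s)%N)
    (hrs : s = r + 2 %[mod q + 1])
    (B : {poly L})
    (hB : forall x : L, x \in mu L (q + 1) -> ~~ root B x)
    (hperm : permutes (mu L (q + 1))
               (fun x : L => x ^+ r * (conj_poly q B).[1 / x] / B.[x]))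
    (a b : L) (ha : a \notin Fq L q) (hb : b \in Fq L q) (hb0 : b != 0) :
  permutes [set: L]
    (fun x : L =>
       ('X^s * (B \Po 'X^(q - 1))
        * (a *: 'X^(2 * (q - 1)) + b *: 'X^(q - 1) + (a ^+ q)%:P)).[x])
  <-> gcdn s (q - 1) = 1%N /\ Tr m (a ^+ (q + 1) / b ^+ 2) != 1.
Proof.
have q_gt1 : (1 < q)%N by rewrite hq -{1}(expn0 2) ltn_exp2l.
have cardL2 : #|L| = (2 ^ (m * 2))%N by rewrite hL hq expnM.
have char2 := card_finPcharP cardL2 (isT : prime 2).
have charq : [pchar L].-nat q by rewrite hq pnatX pnatE ?char2.
have nz_a : a != 0.
  by apply: contraNneq ha => ->; rewrite inE expr0n gtn_eqF // ltnW.
pose M y := a * y ^+ 2 + b * y + a ^+ q.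
pose h y := B.[y] * M y.
set f := fun x : L => _.[x].
have fE x : f x = x ^+ s * h (x ^+ (q - 1)).
  by rewrite /f !hornerE horner_comp !hornerE [(2 * _)%N]mulnC exprM.
have trP := mu_quadratic_root hq hL nz_a hb hb0.
have inj_fE : injective f <-> injective (fun x => x ^+ s * h (x ^+ (q - 1))).
  by split=> inj_f x y; move: (inj_f x y); rewrite !fE.
apply: iff_trans (permutes_setT f) _; apply: iff_trans inj_fE _; split.
  move=> inj_f; split; first exact: inj_power_map_gcdn inj_f.
  apply/eqP => /trP[y y_mu My0].
  have := inj_power_map_neq0 hL hs inj_f y_mu.
  by rewrite /h /M My0 mulr0 eqxx.
case=> cop tr1.
have nz_M y : y \in mu L (q + 1) -> M y != 0.
  by move=> y_mu; apply: contraNneq tr1 => My0; apply/eqP/trP; exists y.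
apply: inj_power_map => //.
  by move=> y y_mu; rewrite mulf_neq0 ?nz_M // -rootE hB.
have [inj_g _] := hperm.
have gE y : y \in mu L (q + 1) ->
    y ^+ s * h y ^+ (q - 1) = y ^+ r * (conj_poly q B).[1 / y] / B.[y].
  move=> y_mu; have nzM := nz_M y y_mu.
  have nzB : B.[y] != 0 by rewrite -rootE hB.
  move: y_mu; rewrite inE unity_rootE => /eqP y1.
  have nz_y : y != 0 by apply: expr_eq1_neq0 y1; rewrite addn1.
  have yq : y ^+ q = 1 / y.
    by apply: (mulIf nz_y); rewrite -exprSr -addn1 y1 divfK.
  have q1 (x : L) : x != 0 -> x ^+ (q - 1) = x ^+ q / x.
    by move=> nz_x; rewrite -[q in RHS](subnK (ltnW q_gt1)) exprD mulfK.
  (* The q-th power exchanges a and a^q, since a^(q^2) = a, fixes b and inverts y, so it reverses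
     the coefficients of [M]. *)
  have Mq : M y ^+ q = M y / y ^+ 2.
    move: hb; rewrite inE => /eqP bq.
    rewrite /M !exprDn_pchar // !exprMn bq -[a ^+ q ^+ q]exprM mulnn -hL expf_card.
    by rewrite yq; field.
  (* Exponents of y count modulo q+1; the factor y^2 cancels the denominator in [Mq]. *)
  have -> : y ^+ s = y ^+ r * y ^+ 2.
    by rewrite -exprD -(expr_mod s y1) hrs expr_mod.
  rewrite -yq horner_conj_poly // exprMn !q1 // Mq.
  by field; rewrite nzM nzB.
by move=> y1 y2 y1_mu y2_mu /=; rewrite !gE //; apply: inj_g.
Qed.
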